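(* Let $G$ be a finite simple group and let $t\ge 2$ be an integer. Let $P:G^t\times G^t\to\{0,1\}$ be a (randomized public-coin) $c$-bit communication protocol. For $g\in G$ let $p_g$ denote the probability that $P(a,b)=1$ assuming $a\bullet b=g$. Then for any $g,h\in G$ we have $|p_g-p_h|\le 2^c(\log|G|)^{-\Omega(t)}$, where the implied positive constant is absolute (the same for all finite simple groups $G$).
   Context: Finite simple groups are taken to be nonabelian. For $a=(a_1,\dots,a_t)$, $b=(b_1,\dots,b_t)\in G^t$ the interleaved product is $a\bullet b=a_1b_1a_2b_2\cdots a_tb_t\in G$. In the protocol one party holds $a$, the other holds $b$; they share public random coins, exchange at most $c$ bits, and the protocol outputs a bit $P(a,b)$. The probability $p_g$ is over the public coins and over $(a,b)$ chosen uniformly from the pairs in $G^t\times G^t$ with $a\bullet b=g$. $\Omega(n)$ denotes a quantity bounded below by $c_0n$ for some positive constant $c_0$. *)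

(* Defs.v *)
From HB Require Import structures.
From mathcomp Require Import all_boot all_order all_algebra.
From mathcomp Require Import all_fingroup all_solvable.
From mathcomp Require Import all_classical all_reals all_analysis.

Set Implicit Arguments.
Unset Strict Implicit.
Unset Printing Implicit Defensive.

Import Order.TTheory GRing.Theory Num.Theory.
Local Open Scope ring_scope.

(* The product is order-sensitive and is taken in increasing order of indices:
   a_1 b_1 a_2 b_2 ... a_t b_t. *)
Definition interleave (G : finGroupType) (t : nat) (a b : t.-tuple G) : G :=
  (\prod_(i < t) (tnth a i * tnth b i))%g.

(* Deterministic two-party protocols are binary trees. At an inner node, the
   named party sends a bit computed from its own input (what has been exchanged
   so far is recorded by the position in the tree); a leaf carries the output.
   The first subtree is followed when the bit is 0, the second when it is 1. *)
Inductive protocol (X Y : Type) : Type :=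
| Output of bool
| Alice of (X -> bool) & protocol X Y & protocol X Y
| Bob of (Y -> bool) & protocol X Y & protocol X Y.

Arguments Output {X Y}.

Fixpoint run (X Y : Type) (p : protocol X Y) (x : X) (y : Y) : bool :=
  match p with
  | Output z => z
  | Alice f p0 p1 => if f x then run p1 x y else run p0 x y
  | Bob f p0 p1 => if f y then run p1 x y else run p0 x y
  end.

Fixpoint cost (X Y : Type) (p : protocol X Y) : nat :=
  match p with
  | Output _ => 0
  | Alice _ p0 p1 => (maxn (cost p0) (cost p1)).+1
  | Bob _ p0 p1 => (maxn (cost p0) (cost p1)).+1
  end.

(* The public coins select a deterministic protocol. They range over an
   arbitrary sample space; measurability makes "the protocol outputs 1 on input
   (x, y)" an event. *)
Record public_coin_protocol (d : measure_display) (C : measurableType d)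
    (X Y : Type) (c : nat) : Type := PublicCoinProtocol {
  det_protocol :> C -> protocol X Y;
  det_protocol_cost : forall w : C, (cost (det_protocol w) <= c)%N;
  det_protocol_measurable : forall (x : X) (y : Y),
    measurable ([set w | run (det_protocol w) x y]%classic : set C)
}.

(* p_g: the coins have law mu, (a, b) is uniform on the pairs with
   interleaved product g, and the coins are independent of (a, b). *)
Definition accept_prob (R : realType) (d : measure_display)
    (C : measurableType d) (mu : probability C R) (G : finGroupType)
    (t c : nat) (P : public_coin_protocol C (t.-tuple G) (t.-tuple G) c)
    (g : G) : R :=
  (\sum_(ab : t.-tuple G * t.-tuple G | interleave ab.1 ab.2 == g)
      fine (mu [set w | run (P w) ab.1 ab.2]%classic))
  / #|[pred ab : t.-tuple G * t.-tuple G | interleave ab.1 ab.2 == g]|%:R.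

(* Main.v *)
Require Import Defs.
From HB Require Import structures.
From mathcomp Require Import all_boot all_order all_algebra.
From mathcomp Require Import all_fingroup all_solvable all_field all_character.
From mathcomp Require Import all_classical all_reals all_analysis.
From mathcomp Require Import ring lra zify.

Set Implicit Arguments.
Unset Strict Implicit.
Unset Printing Implicit Defensive.

Import Order.TTheory GRing.Theory Num.Theory.
Local Open Scope ring_scope.

(** Write N = |G| and let m be the least degree of a nontrivial irreducible
    character of G. For a rectangle A x B, Cauchy-Schwarz over a leaves the
    second moment over b, b' of the events a.b = g and a.b' = g. Averaging over
    a collapses by Schur's lemma: the average of chi(x^a y) is
    chi(x) chi(y) / chi(1), so the second moment is a combination, over the
    nontrivial chi, of the commuting projections onto the chi-isotypic parts of
    functions on G^t, with coefficients chi(1)^(2-2t); by Bessel's inequality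
    the rectangle has discrepancy at most m^(1-t). A protocol is a sum of at
    most 2^c rectangles, and replacing its output z by z - 1/2 saves the factor
    2 lost in comparing g with h.

    That m >= (log N)^(1/7) is Jordan's argument. A unitary representation of a
    simple nonabelian group has no nontrivial element close to 1, because one
    closest to 1 would commute with all its conjugates; so N points of the
    d x d matrices with entries in the unit disc are well separated, whence
    N <= (6d+1)^(2d^2). *)

(** * Character sums *)

(** By Schur's lemma: the sum of the matrices of the conjugates of [x] commutes with the whole
    representation, hence is scalar, and its trace determines the scalar. Multiplying by the matrix
    of [y] and taking traces gives the formula. *)
Lemma irr_conj_sum (gT : finGroupType) (G : {group gT}) (i : Iirr G) x y :
    x \in G -> y \in G ->
  \sum_(a in G) 'chi_i (x ^ a * y)%g
    = #|G|%:R * ('chi_i x * 'chi_i y / 'chi_i 1%g).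
Proof.
move=> Gx Gy; have chi1 := irr1_neq0 i.
have [n [rho [absG n1 chiE]]] : exists n (rho : mx_representation algC G n),
    [/\ mx_absolutely_irreducible rho, 'chi_i 1%g = n%:R
      & forall z, z \in G -> 'chi_i z = \tr (rho z)].
  exists (irr_degree (socle_of_Iirr i)), 'Chi_i; split.
  - exact/groupC/socle_irr.
  - exact: irr1_degree.
  - by move=> z Gz; rewrite -[in LHS]irrRepr cfunE Gz mulr1n.
pose S := \sum_(a in G) rho (x ^ a)%g.
have [e SE] : exists e, S = e%:M.
  apply/is_scalar_mxP; apply: (mx_abs_irr_cent_scalar absG).
  apply/centgmxP => z Gz; rewrite mulmx_suml mulmx_sumr.
  rewrite [RHS](reindex_inj (mulIg z)) /=; apply: eq_big => [a|a Ga].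
    by rewrite groupMr.
  by rewrite -!repr_mxM ?groupJ ?groupM // conjgM -conjgC.
have {}SE : S = (#|G|%:R * 'chi_i x / 'chi_i 1%g)%:M.
  rewrite SE; congr (_%:M); apply: (canRL (mulfK chi1)).
  transitivity (\tr S); first by rewrite SE mxtrace_scalar n1 mulr_natr.
  rewrite raddf_sum /= mulr_natl -sumr_const; apply: eq_bigr => a Ga.
  by rewrite -chiE ?groupJ ?cfunJ.
transitivity (\tr (S *m rho y)).
  rewrite mulmx_suml raddf_sum; apply: eq_bigr => a Ga /=.
  by rewrite -repr_mxM ?groupJ // -chiE // groupM ?groupJ.
by rewrite SE mul_scalar_mx mxtraceZ -chiE //; ring.
Qed.

(** This is the generalized orthogonality relation after the substitution z -> yz. Rescaled, it says
    that the kernels chi(1)/|G| chi(x^-1 y) are pairwise orthogonal idempotents. *)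
Lemma irr_convolution (gT : finGroupType) (G : {group gT}) (i j : Iirr G) x y :
    x \in G -> y \in G ->
  \sum_(z in G) 'chi_i (x^-1 * z)%g * 'chi_j (z^-1 * y)%g
    = (i == j)%:R * (#|G|%:R * 'chi_i (x^-1 * y)%g / 'chi_i 1%g).
Proof.
move=> Gx Gy; rewrite (reindex_inj (mulgI y)) /=.
have G0 : #|G|%:R != 0 :> algC by rewrite pnatr_eq0 -lt0n cardG_gt0.
rewrite -mulrA mulrCA -generalized_orthogonality_relation mulVKf //.
apply: eq_big => [z|z]; first by rewrite groupMl.
rewrite groupMl // => Gz; rewrite invMg mulgKV; congr (_ * _).
by rewrite -(cfunJ _ (z * _)%g Gz) conjgE -!mulgA mulKg.
Qed.

Lemma sumr_bool (R : pzSemiRingType) (T : finType) (B : pred T) :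
  \sum_x (B x)%:R = #|B|%:R :> R.
Proof.
rewrite -sum1_card natr_sum [RHS]big_mkcond.
by apply: eq_bigr => x _; rewrite unfold_in; case: (B x).
Qed.

(** The [E i] are kernels of pairwise orthogonal Hermitian projections. With [v i] the image of the
    indicator of [B], the double sum [q i] is the squared norm of [v i], and the residue [w] has
    squared norm |B| minus the sum of the [q i], which is nonnegative. *)
Lemma bessel_projections (C : numClosedFieldType) (T I : finType)
    (E : I -> T -> T -> C) (B : pred T) :
    (forall i x y, (E i x y)^* = E i y x) ->
    (forall i j x y, \sum_z E i x z * E j z y = (i == j)%:R * E i x y) ->
  (forall i, 0 <= \sum_(x | B x) \sum_(y | B y) E i x y) /\
  \sum_i \sum_(x | B x) \sum_(y | B y) E i x y <= #|B|%:R.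
Proof.
move=> Eherm Emul; pose v i z := \sum_(y | B y) E i z y.
pose q i := \sum_(x | B x) \sum_(y | B y) E i x y.
have vC i z : (v i z)^* = \sum_(x | B x) E i x z.
  by rewrite rmorph_sum; apply: eq_bigr => x _; apply: Eherm.
have vv i j : \sum_z (v i z)^* * v j z = (i == j)%:R * q i.
  under eq_bigr => z _ do rewrite vC big_distrlr.
  rewrite exchange_big /q mulr_sumr; apply: eq_bigr => x _ /=.
  rewrite exchange_big mulr_sumr; apply: eq_bigr => y _ /=.
  exact: Emul.
have q_ge0 i : 0 <= q i.
  have := vv i i; rewrite eqxx mul1r => <-; apply: sumr_ge0 => z _.
  by rewrite mulrC -normCK exprn_ge0.
split=> //; rewrite -/q; pose w z := (B z)%:R - \sum_i v i z.
have vB i : \sum_z (B z)%:R * v i z = q i.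
  rewrite /q (big_mkcond B); apply: eq_bigr => z _ /=.
  by case: (B z); rewrite ?mul1r ?mul0r.
have vB' i : \sum_z (v i z)^* * (B z)%:R = q i.
  rewrite /q exchange_big (big_mkcond B); apply: eq_bigr => z _ /=.
  by rewrite vC; case: (B z); rewrite ?mulr1 ?mulr0.
have : 0 <= \sum_z (w z)^* * w z.
  by apply: sumr_ge0 => z _; rewrite mulrC -normCK exprn_ge0.
have -> : \sum_z (w z)^* * w z = #|B|%:R - \sum_i q i.
  transitivity (\sum_z ((B z)%:R - \sum_i (B z)%:R * v i z
     - \sum_i (v i z)^* * (B z)%:R + \sum_i \sum_j (v i z)^* * v j z)).
    apply: eq_bigr => z _; rewrite /w rmorphB rmorph_nat rmorph_sum /=.
    rewrite -mulr_sumr -mulr_suml -big_distrlr /= mulrBl !mulrBr -natrM.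
    by rewrite mulnb andbb; ring.
  rewrite big_split !sumrB /= sumr_bool.
  have -> : \sum_z \sum_i (B z)%:R * v i z = \sum_i q i.
    by rewrite exchange_big; apply: eq_bigr => i _; apply: vB.
  have -> : \sum_z \sum_i (v i z)^* * (B z)%:R = \sum_i q i.
    by rewrite exchange_big; apply: eq_bigr => i _; apply: vB'.
  have -> : \sum_z \sum_i \sum_j (v i z)^* * v j z = \sum_i q i.
    rewrite exchange_big; apply: eq_bigr => i _; rewrite exchange_big /=.
    under eq_bigr => j _ do rewrite vv.
    rewrite (bigD1 i) //= eqxx mul1r big1 ?addr0 // => j.
    by rewrite eq_sym => /negPf->; rewrite mul0r.
  by rewrite addrNK.
by rewrite subr_ge0.
Qed.

(** * Discrepancy of rectangles *)

Lemma big_tuple_cons (R : Type) (idx : R) (op : Monoid.com_law idx)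
    (T : finType) n (F : n.+1.-tuple T -> R) :
  \big[op/idx]_(a : n.+1.-tuple T) F a
    = \big[op/idx]_(x : T) \big[op/idx]_(a : n.-tuple T) F [tuple of x :: a].
Proof.
rewrite pair_bigA (reindex (fun p : T * n.-tuple T => [tuple of p.1 :: p.2])) //.
exists (fun a : n.+1.-tuple T => (thead a, [tuple of behead a])) => [[x a] _|a _].
  by rewrite theadE; congr (_, _); apply: val_inj.
by rewrite -tuple_eta.
Qed.

Lemma big_distr_tuple (R : comPzSemiRingType) (T : finType) n
    (F : 'I_n -> T -> R) :
  \sum_(c : n.-tuple T) \prod_(k < n) F k (tnth c k)
    = \prod_(k < n) \sum_(z : T) F k z.
Proof.
elim: n F => [|n IH] F.
  rewrite big_ord0 (eq_bigr (fun=> 1)) => [|c _]; last by rewrite big_ord0.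
  by rewrite sumr_const card_tuple expn0.
rewrite big_tuple_cons big_ord_recl mulr_suml; apply: eq_bigr => x _.
rewrite -IH mulr_sumr; apply: eq_bigr => c _.
by rewrite big_ord_recl tnth0; congr (_ * _); apply: eq_bigr => k _; rewrite tnthS.
Qed.

Lemma interleave_cons (gT : finGroupType) n x y (a b : n.-tuple gT) :
  interleave [tuple of x :: a] [tuple of y :: b] = (x * y * interleave a b)%g.
Proof.
rewrite /interleave big_ord_recl !tnth0; congr (_ * _)%g.
by apply: eq_bigr => k _; rewrite !tnthS.
Qed.

(** Induction on the length, with [s] free. Up to conjugation, the first entry of [a] acts only by
    conjugating [s], so averaging over it splits off chi(s)/chi(1). What remains is the same sum for
    the shorter tuples, with x^-1 y in place of [s]. *)
Lemma sum_irr_interleave (gT : finGroupType) (i : Iirr [set: gT]) n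
    (b b' : n.-tuple gT) s :
  \sum_(a : n.-tuple gT) 'chi_i ((interleave a b)^-1 * s * interleave a b')%g
    = #|gT|%:R ^+ n * ('chi_i s * \prod_(k < n)
        ('chi_i ((tnth b k)^-1 * tnth b' k)%g / 'chi_i 1%g)).
Proof.
elim: n b b' s => [|n IH] b b' s.
  rewrite big_ord0 expr0 mulr1 mul1r (eq_bigr (fun=> 'chi_i s)) => [|a _].
    by rewrite sumr_const card_tuple expn0.
  by rewrite /interleave !big_ord0 invg1 mul1g mulg1.
case/tupleP: b => x b; case/tupleP: b' => y b'.
rewrite big_tuple_cons exchange_big big_ord_recl !tnth0 /=.
under [X in _ = _ * (_ * (_ * X))]eq_bigr => k _ do rewrite !tnthS.
pose c := 'chi_i s / 'chi_i 1%g * #|gT|%:R.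
transitivity (c * \sum_a 'chi_i
    ((interleave a b)^-1 * (x^-1 * y) * interleave a b')%g); last first.
  by rewrite IH /c exprS; ring.
rewrite mulr_sumr; apply: eq_bigr => a _.
have G1 z : z \in [set: gT]%G by rewrite inE.
transitivity (\sum_(z in [set: gT]%G) 'chi_i
  (s ^ z * (y * interleave a b' * (interleave a b)^-1 * x^-1))%g).
  rewrite [RHS](eq_bigl xpredT) => [|z]; last by rewrite inE.
  apply: eq_bigr => z _; rewrite !interleave_cons !invMg.
  rewrite -[LHS](cfunJ _ _ (G1 ((interleave a b)^-1 * x^-1)%g)) !conjgE.
  by rewrite !invMg !invgK !mulgA mulgK mulgV mul1g.
rewrite irr_conj_sum ?G1 // cardsT /c.
rewrite -(cfunJ _ (y * _ * _ * _)%g (G1 (x * interleave a b)%g)).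
by rewrite conjgE !invMg !mulgA !mulgKV; ring.
Qed.

Lemma sum_irr_regular (gT : finGroupType) (G : {group gT}) x :
  \sum_(i : Iirr G) 'chi_i 1%g * 'chi_i x = #|G|%:R * (x == 1%g)%:R.
Proof.
transitivity (cfReg G x); last by rewrite cfRegE mulr_natr.
by rewrite cfReg_sum sum_cfunE; apply: eq_bigr => i _; rewrite cfunE.
Qed.

(** A left translation of both products is absorbed by the first entry of [a]; this is why the
    tuples must be nonempty. *)
Lemma sum_interleave_shift (R : nmodType) (gT : finGroupType) n
    (F : gT -> gT -> R) (b b' : n.+1.-tuple gT) g :
  \sum_(a : n.+1.-tuple gT) F (g * interleave a b)%g (g * interleave a b')%g
    = \sum_(a : n.+1.-tuple gT) F (interleave a b) (interleave a b').
Proof.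
case/tupleP: b => x b; case/tupleP: b' => y b'.
rewrite !big_tuple_cons [RHS](reindex_inj (mulgI g)).
apply: eq_bigr => z _; apply: eq_bigr => a _.
by rewrite !interleave_cons !mulgA.
Qed.

(** By translation the sum on the left does not depend on [g]; adding it up over all group elements
    counts the coincidences of the two products. *)
Lemma sum_interleave_eq (R : pzSemiRingType) (gT : finGroupType) n
    (b b' : n.+1.-tuple gT) g :
  #|gT|%:R * \sum_(a : n.+1.-tuple gT)
      (interleave a b == g)%:R * (interleave a b' == g)%:R
    = \sum_(a : n.+1.-tuple gT) (interleave a b == interleave a b')%:R :> R.
Proof.
pose F (h u v : gT) : R := (u == h)%:R * (v == h)%:R.
transitivity (\sum_(h : gT) \sum_(a : n.+1.-tuple gT)
    F h (interleave a b) (interleave a b')).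
  rewrite mulr_natl -sumr_const; apply: eq_big => // h _.
  rewrite -[RHS](sum_interleave_shift _ _ _ (h * g^-1)%g).
  apply: eq_bigr => a _; rewrite /F.
  have E u : (h * g^-1 * u == h)%g = (u == g).
    by rewrite -mulgA -[X in _ == X]mulg1 (inj_eq (mulgI h)) -eq_mulVg1 eq_sym.
  by rewrite !E.
rewrite exchange_big; apply: eq_bigr => a _ /=.
rewrite (bigD1 (interleave a b)) //= big1 => [|h neq_h].
  by rewrite /F eqxx mul1r addr0 eq_sym.
by rewrite /F eq_sym (negPf neq_h) mul0r.
Qed.

Lemma sum_interleave_fiber (R : pzSemiRingType) (gT : finGroupType) n
    (b : n.+1.-tuple gT) g :
  #|gT|%:R * \sum_(a : n.+1.-tuple gT) (interleave a b == g)%:R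
    = #|gT|%:R ^+ n.+1 :> R.
Proof.
transitivity (\sum_(a : n.+1.-tuple gT) (interleave a b == interleave a b)%:R : R);
  last first.
  under eq_bigr => a _ do rewrite eqxx.
  by rewrite sumr_const card_tuple natrX.
rewrite -(sum_interleave_eq _ _ _ g); congr (_ * _); apply: eq_bigr => a _.
by rewrite -natrM mulnb andbb.
Qed.

(** The event a.b = g, centred so that it has mean zero over [a]. The scaling by |G| makes the
    values integers, so a bound proved over [algC] can be carried through [int] to any real
    field. *)
Definition imbalance (R : pzRingType) (gT : finGroupType) n (g : gT)
  (a b : n.-tuple gT) : R := #|gT|%:R * (interleave a b == g)%:R - 1.

(** After expansion, only the coincidence indicator of the two products is not constant. The regular
    character writes it as a sum over all irreducible characters, and the trivial one cancels the
    constants. *)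
Lemma imbalance_second_moment (gT : finGroupType) n (g : gT)
    (b b' : n.+1.-tuple gT) :
  \sum_(a : n.+1.-tuple gT) imbalance algC g a b * imbalance algC g a b'
    = #|gT|%:R ^+ n.+1 * \sum_(i : Iirr [set: gT] | i != 0) 'chi_i 1%g ^+ 2 *
        \prod_(k < n.+1) ('chi_i ((tnth b k)^-1 * tnth b' k)%g / 'chi_i 1%g).
Proof.
set N : algC := #|gT|%:R.
transitivity (\sum_(a : n.+1.-tuple gT)
   (N * (N * ((interleave a b == g)%:R * (interleave a b' == g)%:R))
   - N * (interleave a b == g)%:R - N * (interleave a b' == g)%:R + 1)).
  by apply: eq_bigr => a _; rewrite /imbalance -/N; ring.
rewrite big_split !sumrB /= -!mulr_sumr !sum_interleave_fiber sum_interleave_eq.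
rewrite sumr_const card_tuple natrX addrNK.
have -> : N * \sum_(a : n.+1.-tuple gT) (interleave a b == interleave a b')%:R
    = N ^+ n.+1 * \sum_(i : Iirr [set: gT]) 'chi_i 1%g ^+ 2 *
        \prod_(k < n.+1) ('chi_i ((tnth b k)^-1 * tnth b' k)%g / 'chi_i 1%g).
  transitivity (\sum_(a : n.+1.-tuple gT) \sum_(i : Iirr [set: gT])
      'chi_i 1%g * 'chi_i ((interleave a b)^-1 * 1 * interleave a b')%g).
    rewrite mulr_sumr; apply: eq_bigr => a _.
    by rewrite sum_irr_regular cardsT mulg1 -eq_mulVg1.
  rewrite exchange_big mulr_sumr; apply: eq_bigr => i _.
  by rewrite -mulr_sumr sum_irr_interleave -/N /=; ring.
rewrite (bigD1 0) //= mulrDr [X in X + _ - _](_ : _ = N ^+ n.+1); last first.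
  rewrite irr0 !cfun1E inE expr1n mul1r big1 ?mulr1 // => k _.
  by rewrite !cfun1E !inE divr1.
by rewrite addrAC subrr add0r.
Qed.

(** Cauchy-Schwarz against a constant, from the variance identity n(nQ - S^2) = sum of (ns - S)^2.
    Cancelling n needs a nonempty [A], so the empty case is separate. *)
Lemma sqr_sum_le (R : numDomainType) (T : finType) (A : pred T) (s : T -> R) :
    (forall x, s x \is Num.real) ->
  (\sum_(x | A x) s x) ^+ 2 <= #|A|%:R * \sum_(x | A x) s x ^+ 2.
Proof.
move=> s_real; set S := \sum_(x | A x) s x; set Q := \sum_(x | A x) s x ^+ 2.
pose n : R := #|A|%:R.
have S_real : S \is Num.real by apply: rpred_sum.
have sum1 : \sum_(x | A x) 1 = n by rewrite sumr_const.
have : 0 <= n * (n * Q - S ^+ 2).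
  have -> : n * (n * Q - S ^+ 2) = \sum_(x | A x) (n * s x - S) ^+ 2.
    transitivity (\sum_(x | A x)
      (n ^+ 2 * s x ^+ 2 - 2 * n * S * s x + S ^+ 2 * 1)).
      rewrite big_split sumrB -!mulr_sumr /= sum1 -/S -/Q; ring.
    by apply: eq_bigr => x _; ring.
  apply: sumr_ge0 => x _; rewrite -realEsqr.
  by rewrite rpredB ?rpredM ?realn.
have [A0|A_gt0] := posnP #|A|.
  have -> : S = 0.
    rewrite /S big1 // => x Ax.
    by have := card0_eq A0 x; rewrite !inE unfold_in Ax.
  by rewrite A0 mul0r expr0n.
by rewrite pmulr_rge0 ?ltr0n // subr_ge0.
Qed.

Lemma rectangle_imbalance (gT : finGroupType) n m (g : gT)
    (A B : pred (n.+1.-tuple gT)) :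
    (forall i : Iirr [set: gT], i != 0 -> m%:R <= 'chi_i 1%g) ->
  m%:R ^+ n * `|\sum_(a | A a) \sum_(b | B b) imbalance int g a b|
    <= #|gT|%:R ^+ (2 * n.+1).
Proof.
move=> m_le; set N : int := #|gT|%:R; set X := \sum_(a | A a) _.
pose Nc : algC := #|gT|%:R.
have Nc_gt0 : 0 < Nc by rewrite ltr0n -cardsT cardG_gt0.
pose s a : algC := \sum_(b | B b) imbalance algC g a b.
have XE : X%:~R = \sum_(a | A a) s a.
  rewrite rmorph_sum; apply: eq_bigr => a _; rewrite rmorph_sum.
  by apply: eq_bigr => b _; rewrite /imbalance rmorphB rmorphM !rmorph_nat.
have s_real a : s a \is Num.real.
  by apply: rpred_sum => b _; rewrite /imbalance rpredB ?rpredM ?realn ?real1.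
(* A tensor product over the coordinates: in each of them, the isotypic projection attached to
   ['chi_i]. *)
pose E (i : Iirr [set: gT]) (b b' : n.+1.-tuple gT) : algC :=
  \prod_(k < n.+1) ('chi_i 1%g / Nc * 'chi_i ((tnth b k)^-1 * tnth b' k)%g).
have [q_ge0 q_sum] : (forall i, 0 <= \sum_(x | B x) \sum_(y | B y) E i x y) /\
    \sum_i \sum_(x | B x) \sum_(y | B y) E i x y <= #|B|%:R.
  apply: bessel_projections => [i x y|i j x y].
    rewrite rmorph_prod; apply: eq_bigr => k _.
    rewrite rmorphM fmorph_div irr1_degree !rmorph_nat /= -irr_inv.
    by rewrite invMg invgK.
  under eq_bigr => z _ do rewrite /E -big_split /=.
  pose F k z := 'chi_i 1%g / Nc * 'chi_i ((tnth x k)^-1 * z)%g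
     * ('chi_j 1%g / Nc * 'chi_j (z^-1 * tnth y k)%g).
  rewrite (big_distr_tuple F) /F.
  have conv k : \sum_z F k z = (i == j)%:R * ('chi_i 1%g / Nc
      * 'chi_i ((tnth x k)^-1 * tnth y k)%g).
    transitivity ('chi_i 1%g / Nc * ('chi_j 1%g / Nc) *
      \sum_(z in [set: gT])
        'chi_i ((tnth x k)^-1 * z)%g * 'chi_j (z^-1 * tnth y k)%g).
      rewrite mulr_sumr; apply: eq_big => [z|z _]; first by rewrite inE.
      by rewrite /F; ring.
    rewrite irr_convolution ?inE // cardsT -/Nc.
    have [<-|] := eqVneq i j; last by rewrite !mul0r mulr0.
    by field; rewrite irr1_neq0 gt_eqF.
  under eq_bigr => k _ do rewrite -/(F k _) conv.
  (* For i != j the product vanishes because there is at least one coordinate. *)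
  rewrite big_split /=; case: (i == j); first by rewrite big1_eq.
  by rewrite big_ord_recl !mul0r.
(* Normalizing each of the n+1 factors to a projection costs |G|/chi(1)^2; together with the factor
   chi(1)^2 of the second moment this leaves chi(1)^(-2n). *)
have moment : \sum_a s a ^+ 2 = Nc ^+ (2 * n.+1) * \sum_(i | i != 0)
    ('chi_i 1%g ^+ (2 * n))^-1 * \sum_(x | B x) \sum_(y | B y) E i x y.
  transitivity (\sum_(b | B b) \sum_(b' | B b') \sum_a
      imbalance algC g a b * imbalance algC g a b').
    under eq_bigr => a _ do rewrite expr2 /s big_distrlr.
    rewrite exchange_big; apply: eq_bigr => b _.
    by rewrite exchange_big.
  under eq_bigr => b _ do under eq_bigr => b' _ do
    rewrite imbalance_second_moment -/Nc mulr_sumr.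
  under eq_bigr => b _ do rewrite exchange_big.
  rewrite exchange_big mulr_sumr; apply: eq_bigr => i _ /=.
  rewrite mulrA mulr_sumr; apply: eq_bigr => b _; rewrite mulr_sumr.
  apply: eq_bigr => b' _; have chi1 := irr1_neq0 i.
  have Nc0 : Nc != 0 by rewrite gt_eqF.
  have -> : E i b b' = ('chi_i 1%g ^+ 2 / Nc) ^+ n.+1 *
      \prod_(k < n.+1) ('chi_i ((tnth b k)^-1 * tnth b' k)%g / 'chi_i 1%g).
    rewrite (_ : _ ^+ n.+1 = \prod_(k < n.+1) ('chi_i 1%g ^+ 2 / Nc)).
      rewrite -big_split.
      by apply: eq_bigr => k _ /=; field; rewrite chi1.
    by rewrite prodr_const card_ord.
  rewrite ![(2 * _)%N]mulnC exprMn exprVn [_ ^+ 2 ^+ _]exprAC.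
  by rewrite !exprM !exprS !expr0; field; rewrite ?expf_neq0 ?chi1 ?Nc0.
(* Squares avoid roots: Cauchy-Schwarz over [A] and Bessel over [B] each cost |G|^(n+1), and the
   second moment contributes |G|^(2(n+1)). *)
have key : (m%:R ^+ n * X%:~R) ^+ 2 <= (Nc ^+ (2 * n.+1)) ^+ 2.
  have N_ge0 k : 0 <= Nc ^+ k by rewrite exprn_ge0 // ltW.
  have cardT (C : pred (n.+1.-tuple gT)) : #|C|%:R <= Nc ^+ n.+1.
    by rewrite -natrX ler_nat -card_tuple max_card.
  have sA : (X%:~R : algC) ^+ 2 <= Nc ^+ n.+1 * \sum_a s a ^+ 2.
    rewrite XE (le_trans (sqr_sum_le A s_real)) // ler_pM //.
      by apply: sumr_ge0 => a _; rewrite -realEsqr.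
    rewrite [leRHS](bigID A) /= lerDl.
    by apply: sumr_ge0 => a _; rewrite -realEsqr.
  have sB : (m%:R ^+ n) ^+ 2 * \sum_a s a ^+ 2 <= Nc ^+ (2 * n.+1) * Nc ^+ n.+1.
    rewrite moment mulrCA ler_wpM2l // mulr_sumr.
    apply: le_trans (le_trans q_sum (cardT B)).
    (* The trivial character may be put back, since its term is nonnegative. *)
    rewrite [leRHS](bigD1 0) //= -[leLHS]add0r lerD ?q_ge0 //.
    apply: ler_sum => i i0; rewrite mulrA ler_piMl ?q_ge0 //.
    rewrite -exprM mulnC ler_pdivrMr ?exprn_gt0 ?irr1_gt0 // mul1r.
    by rewrite lerXn2r ?nnegrE ?ler0n ?m_le // ltW ?irr1_gt0.
  rewrite exprMn; apply: le_trans (ler_wpM2l _ sA) _.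
    by rewrite -exprM exprn_ge0.
  rewrite mulrCA; apply: le_trans (ler_wpM2l (N_ge0 _) sB) _.
  by rewrite -!exprD -exprM (_ : (_ + _)%N = (2 * n.+1 * 2)%N) //; lia.
have : `|m%:R ^+ n * X%:~R| <= Nc ^+ (2 * n.+1).
  rewrite -ler_sqr ?nnegrE ?exprn_ge0 ?normr_ge0 ?(ltW Nc_gt0) //.
  by rewrite real_normK // realM ?realX ?realn ?realz.
rewrite normrM ger0_norm ?exprn_ge0 ?ler0n // -intr_norm.
by rewrite -(ler_int algC) rmorphM !rmorphXn /N !rmorph_nat /=.
Qed.

(** * Unitary representations of simple groups *)

Section UnitaryRepresentations.
Local Open Scope sesquilinear_scope.

(** Diagonalize [H] in a unitary basis. The eigenvalues are values of the form on the rows of [P],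
    hence positive, and their square roots give [B]. *)
Lemma posdef_factor (C : numClosedFieldType) n (H : 'M[C]_n) :
    H ^t* = H -> (forall v : 'rV[C]_n, v != 0 -> 0 < (v *m H *m v ^t*) 0 0) ->
  exists2 B : 'M[C]_n, B \in unitmx & B *m B ^t* = H.
Proof.
move=> Hherm Hpos; pose P := spectralmx H; pose D := spectral_diag H.
have unitaryP : P \is unitarymx by apply: spectral_unitarymx.
have unitP : P \in unitmx by apply: spectral_unit.
have HE : H = P ^t* *m diag_mx D *m P.
  rewrite -invmx_unitary //; apply/orthomx_spectralP/normalmxP.
  by rewrite Hherm.
have D_gt0 i : 0 < D 0 i.
  have : 0 < (row i P *m H *m (row i P) ^t*) 0 0.
    apply: Hpos; apply/negP => /eqP rowP0.
    have /row_unitarymxP/(_ i i) := unitaryP.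
    by rewrite rowP0 linear0l eqxx => /eqP; rewrite eq_sym oner_eq0.
  have -> : (row i P *m H *m (row i P) ^t*) 0 0 = (P *m H *m P ^t*) i i.
    by rewrite -row_mul !mxE; apply: eq_bigr => k _; rewrite !mxE.
  rewrite HE !mulmxA (unitarymxP unitaryP) mul1mx -mulmxA.
  by rewrite (unitarymxP unitaryP) mulmx1 mxE eqxx.
pose S := diag_mx (map_mx sqrtC D).
have SE : S *m S ^t* = diag_mx D.
  rewrite /S tr_diag_mx map_diag_mx mulmx_diag; congr diag_mx.
  apply/rowP => i; rewrite !mxE [X in _ * X]geC0_conj ?sqrtC_ge0 ?ltW //.
  by rewrite -expr2 sqrtCK.
exists (P ^t* *m S); last first.
  by rewrite trmx_mul map_mxM trmxCK HE -SE !mulmxA.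
rewrite unitmx_mul -invmx_unitary // unitmx_inv unitP unitmxE det_diag.
rewrite unitfE; apply/prodf_neq0 => i _.
by rewrite mxE sqrtC_eq0 gt_eqF.
Qed.

(** Weyl's averaging trick: the sum [H] of the rho(g) rho(g)^* is invariant and positive definite,
    so conjugation by a factor [B] of [H] makes the representation unitary. *)
Lemma unitary_conjugate (gT : finGroupType) (G : {group gT}) n
    (rG : mx_representation algC G n) :
  exists2 rU : mx_representation algC G n,
    rker rU = rker rG & forall x, x \in G -> rU x \is unitarymx.
Proof.
pose H := \sum_(g in G) rG g *m (rG g) ^t*.
have rH x : x \in G -> rG x *m H *m (rG x) ^t* = H.
  move=> Gx; rewrite mulmx_sumr mulmx_suml [RHS](reindex_inj (mulgI x)).
  apply: eq_big => [g|g Gg]; first by rewrite groupMl.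
  by rewrite repr_mxM // trmx_mul map_mxM !mulmxA.
have [||B unitB BE] := @posdef_factor _ _ H.
- rewrite /H raddf_sum (raddf_sum (map_mx Num.conj)); apply: eq_bigr => g _.
  by rewrite /= trmx_mul map_mxM trmxCK.
- move=> v v0; rewrite mulmx_sumr mulmx_suml summxE.
  rewrite (bigD1 1%g) //= ltr_pwDl //.
    have := dotmx_is_dotmx v0; rewrite dotmxE repr_mx1 trmx1 map_mx1.
    by rewrite !mulmx1.
  apply: sumr_ge0 => g _; rewrite mulmxA -mulmxA -map_mxM -trmx_mul.
  by rewrite -dotmxE dnorm_ge0.
pose V := invmx B; have unitV : V \in unitmx by rewrite unitmx_inv.
exists (rconj_repr rG unitV); first exact: rker_conj.
move=> x Gx; apply/unitarymxP; rewrite /= /rconj_mx /V invmxK.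
rewrite !trmx_mul !map_mxM !mulmxA -(mulmxA _ B) BE -!(mulmxA (invmx B)) rH //.
by rewrite -BE !mulmxA mulVmx // mul1mx -map_mxM -trmx_mul mulVmx // trmx1 map_mx1.
Qed.

(** The squared Frobenius norm. *)
Definition sqnormmx (C : numClosedFieldType) m n (A : 'M[C]_(m, n)) : C :=
  \sum_i \sum_j `|A i j| ^+ 2.

Lemma sqnormmxE (C : numClosedFieldType) m n (A : 'M[C]_(m, n)) :
  sqnormmx A = \tr (A *m A ^t*).
Proof.
apply: eq_bigr => i _; rewrite mxE; apply: eq_bigr => j _.
by rewrite !mxE normCK.
Qed.

Lemma sqnormmx_ge0 (C : numClosedFieldType) m n (A : 'M[C]_(m, n)) :
  0 <= sqnormmx A.
Proof. by apply: sumr_ge0 => i _; apply: sumr_ge0 => j _; rewrite exprn_ge0. Qed.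

Lemma sqnormmx_eq0 (C : numClosedFieldType) m n (A : 'M[C]_(m, n)) :
  sqnormmx A = 0 -> A = 0.
Proof.
move=> A0; apply/matrixP => i j; rewrite mxE; apply/eqP.
rewrite -normr_eq0 -sqrf_eq0; apply/eqP.
have sq_ge0 k : 0 <= `|A i k| ^+ 2 by rewrite exprn_ge0.
apply: (psumr_eq0P (P := xpredT) (F := fun k => `|A i k| ^+ 2)) => // {j}.
apply: (psumr_eq0P (P := xpredT) (F := fun i => \sum_k `|A i k| ^+ 2)) => // k _.
by apply: sumr_ge0 => l _; rewrite exprn_ge0.
Qed.

Lemma sqnormmxMr_unitary (C : numClosedFieldType) m n (A : 'M[C]_(m, n)) (U : 'M[C]_n) :
  U \is unitarymx -> sqnormmx (A *m U) = sqnormmx A.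
Proof.
move=> unitaryU; rewrite !sqnormmxE trmx_mul map_mxM mulmxA mulmxtVK //.
Qed.

Lemma sqnormmxMl_unitary (C : numClosedFieldType) m n (A : 'M[C]_(m, n)) (U : 'M[C]_m) :
  U \is unitarymx -> sqnormmx (U *m A) = sqnormmx A.
Proof.
move=> unitaryU; rewrite !sqnormmxE trmx_mul map_mxM mxtrace_mulC !mulmxA.
by rewrite mulmxKtV // mxtrace_mulC.
Qed.

Lemma sqnormmxM (C : numClosedFieldType) m n p (A : 'M[C]_(m, n)) (B : 'M[C]_(n, p)) :
  sqnormmx (A *m B) <= sqnormmx A * sqnormmx B.
Proof.
rewrite [X in X * _]/sqnormmx mulr_suml; apply: ler_sum => i _.
rewrite /sqnormmx [X in _ * X]exchange_big mulr_sumr; apply: ler_sum => j _ /=.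
have CS (u v : 'rV[C]_n) : `|dotmx u v| ^+ 2 <= dotmx u u * dotmx v v.
  by have [] := CauchySchwarz (@dotmx C n) u v.
pose u := row i A; pose v := row j (B ^t*).
have -> : (A *m B) i j = dotmx u v.
  by rewrite dotmxE !mxE; apply: eq_bigr => k _; rewrite !mxE conjCK.
have -> : \sum_k `|A i k| ^+ 2 = dotmx u u.
  by rewrite dotmxE mxE; apply: eq_bigr => k _; rewrite !mxE normCK.
have -> : \sum_k `|B k j| ^+ 2 = dotmx v v.
  by rewrite dotmxE mxE; apply: eq_bigr => k _; rewrite !mxE conjCK normCK mulrC.
exact: CS.
Qed.

Lemma sqnormmxB (C : numClosedFieldType) m n (A B : 'M[C]_(m, n)) :
  sqnormmx (A - B) <= 2 * (sqnormmx A + sqnormmx B).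
Proof.
rewrite /sqnormmx -big_split mulr_sumr; apply: ler_sum => i _ /=.
rewrite -big_split mulr_sumr; apply: ler_sum => j _ /=.
rewrite !mxE -subr_ge0.
have -> : 2 * (`|A i j| ^+ 2 + `|B i j| ^+ 2) - `|A i j - B i j| ^+ 2
    = `|A i j + B i j| ^+ 2.
  by rewrite !normCK rmorphB rmorphD /=; ring.
by rewrite exprn_ge0.
Qed.

(** Unitary invariance reduces this to the distance from 1. The threshold 1/4 is where 4 N(x)^2 <
    N(x) begins to hold for N(x) > 0, the positivity coming from faithfulness. Below it, a minimal
    [x] commutes with its conjugates, which generate G by simplicity, so G would be abelian. *)
Lemma simple_unitary_separated (gT : finGroupType) (G : {group gT}) n
    (rU : mx_representation algC G n) x y :
    simple G -> ~~ abelian G -> mx_faithful rU ->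
    (forall x, x \in G -> rU x \is unitarymx) ->
  x \in G -> y \in G -> x != y -> 4^-1 <= sqnormmx (rU x - rU y).
Proof.
move=> simpleG nabG faithU unitaryU Gx Gy neq_xy.
pose N z := sqnormmx (rU z - 1%:M).
suff {x y Gx Gy neq_xy} Nlarge z : z \in G^#%g -> 4^-1 <= N z.
  have <- : N (x * y^-1)%g = sqnormmx (rU x - rU y).
    rewrite /N -(sqnormmxMr_unitary _ (unitaryU y Gy)) mulmxBl mul1mx.
    by rewrite -repr_mxM ?groupM ?groupV // mulgKV.
  apply: Nlarge; rewrite !inE groupM ?groupV // andbT.
  by rewrite -eq_mulgV1.
move=> Pz; have Nreal w : w \in G^#%g -> N w \is Num.real.
  by move=> _; rewrite ger0_real ?sqnormmx_ge0.
have [x Px xmin] := real_arg_minP Pz Nreal.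
apply: le_trans (xmin _ Pz).
have /setD1P[x1 Gx] := Px.
rewrite real_leNgt ?Nreal // ?rpredV ?realn //; apply/negP => Nx_lt.
have N_gt0 : 0 < N x.
  rewrite lt_def sqnormmx_ge0 andbT; apply: contra x1 => /eqP/sqnormmx_eq0 Ux.
  have /fintype.subsetP/(_ x) := faithU; rewrite !inE Gx mul1mx /= -subr_eq0 Ux eqxx.
  exact.
have NJ a : a \in G -> N (x ^ a)%g = N x.
  move=> Ga; rewrite /N conjgE !repr_mxM ?groupM ?groupV //.
  rewrite -(sqnormmxMl_unitary _ (unitaryU _ Ga)).
  rewrite -[RHS](sqnormmxMr_unitary _ (unitaryU _ Ga)).
  congr sqnormmx; rewrite mulmxBr mulmxBl !mulmxA -repr_mxM ?groupV //.
  by rewrite mulgV repr_mx1 !mul1mx mulmx1.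
(* The squared distance to 1 of [~ x, y] is at most 4 times the product of those
   of x and y, so it would be smaller than the minimum N x. *)
have commJ a : a \in G -> commute x (x ^ a)%g.
  move=> Ga; set y := (x ^ a)%g; have Gy : y \in G by rewrite groupJ.
  apply/commgP; apply: contraT => c1.
  have Pc : [~ x, y]%g \in G^#%g by rewrite !inE c1 groupR.
  have := xmin _ Pc; rewrite real_leNgt ?Nreal // => /negP[].
  (* Multiplying [x,y] - 1 on the left by the unitary matrix of yx gives xy - yx, which is the
     commutator of x - 1 and y - 1. *)
  have -> : N [~ x, y]%g = sqnormmx
      ((rU x - 1%:M) *m (rU y - 1%:M) - (rU y - 1%:M) *m (rU x - 1%:M)).
    rewrite /N -(sqnormmxMl_unitary _ (unitaryU _ (groupM Gy Gx))).
    rewrite mulmxBr mulmx1 -(repr_mxM _ (groupM Gy Gx) (groupR Gx Gy)).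
    rewrite commgEl mulgA mulgK -conjgC.
    rewrite (repr_mxM _ Gx Gy) (repr_mxM _ Gy Gx).
    rewrite !mulmxBl !mulmxBr !mulmx1 !mul1mx.
    set X := rU x; set Y := rU y; rewrite -[_ - X - _]addrA -[_ - Y - _]addrA.
    by rewrite -!opprD [Y + (X - _)]addrCA opprB subrKA.
  apply: le_lt_trans (sqnormmxB _ _) _.
  have qxy : sqnormmx ((rU x - 1%:M) *m (rU y - 1%:M)) <= N x * N x.
    by rewrite -{2}(NJ a Ga) sqnormmxM.
  have qyx : sqnormmx ((rU y - 1%:M) *m (rU x - 1%:M)) <= N x * N x.
    by rewrite -{1}(NJ a Ga) sqnormmxM.
  apply: le_lt_trans (ler_wpM2l _ (lerD qxy qyx)) _ => //.
  have -> : 2 * (N x * N x + N x * N x) = 4 * N x * N x by ring.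
  by rewrite -[ltRHS]mul1r ltr_pM2r // -ltr_pdivlMl ?mulr1 ?ltr0n.
have [_ simplG] := simpleP _ simpleG.
have nsC : normal <<x ^: G>>%g G.
  by rewrite /normal gen_subG class_subG //= norms_gen // class_norm.
case: (simplG _ nsC) => [E1|EG].
  by case/negP: x1; have := mem_gen (class_refl G x); rewrite E1 => /set1P ->.
case/negP: nabG; rewrite -EG abelian_gen.
apply/centsP => u /imsetP[a Ga ->] v /imsetP[b Gb ->].
(* Conjugating by [a] carries the commutation of x and x^(b a^-1) to that of x^a and x^b. *)
have := congr1 (conjg^~ a) (commJ (b * a^-1)%g (groupM Gb (groupVr Ga))).
by rewrite /= (conjMg x) (conjMg _ x) -!conjgM mulgKV.
Qed.

(** * Packing bound for separated unitary matrices *)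

(* Meaningful only for real z with |z| <= 1: elsewhere inord may give 0. *)
Definition grid_cell (n : nat) (z : algC) : 'I_(6 * n).+1 :=
  inord `|(Num.floor ((3 * n)%:R * z) + (3 * n)%:Z)%R|.

(** On [-1, 1] the floor of 3nz lies between -3n and 3n, so neither the absolute value nor [inord]
    loses information. Equal cells then mean equal floors, and 3nz and 3nw differ by at most 1. *)
Lemma grid_cell_close n (z w : algC) :
    z \is Num.real -> w \is Num.real -> `|z| <= 1 -> `|w| <= 1 ->
  grid_cell n z = grid_cell n w -> ((3 * n)%:R * (z - w)) ^+ 2 <= 1.
Proof.
move=> zR wR z1 w1; set c : algC := (3 * n)%:R.
have cR : c \is Num.real by apply: realn.
have bounds (u : algC) : u \is Num.real -> `|u| <= 1 ->
    (- (3 * n)%:Z <= Num.floor (c * u) <= (3 * n)%:Z)%R.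
  move=> uR; rewrite real_ler_norml // => /andP[uN1 u1].
  have cuR : c * u \is Num.real by rewrite realM.
  rewrite real_floor_ge_int // -(ler_int algC) rmorphN /= -/c.
  apply/andP; split; first by rewrite -[leLHS]mulrN1 ler_wpM2l ?ler0n.
  apply: le_trans (real_floor_le cuR) _.
  by rewrite -[leRHS]mulr1 ler_wpM2l ?ler0n.
have /andP[zl zu] := bounds z zR z1; have /andP[wl wu] := bounds w wR w1.
rewrite /grid_cell -/c => /(congr1 (@nat_of_ord _)); rewrite !inordK; [|lia|lia].
move=> eq_abs; have {eq_abs zl zu wl wu} eq_floor :
    Num.floor (c * z) = Num.floor (c * w) by lia.
have czR : c * z \is Num.real by rewrite realM.
have cwR : c * w \is Num.real by rewrite realM.
have /andP[zl zu] := real_floor_itv czR; have /andP[wl wu] := real_floor_itv cwR.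
rewrite mulrBr -real_normK ?realB // exprn_ile1 //.
rewrite real_ler_norml ?realB //; apply/andP; split.
  have := lerB zl (ltW wu).
  by rewrite eq_floor intrD opprD addrA subrr add0r.
have := lerB (ltW zu) wl.
by rewrite eq_floor intrD addrAC subrr add0r.
Qed.

Lemma unitarymx_entry (C : numClosedFieldType) n (U : 'M[C]_n) i j :
  U \is unitarymx -> `|U i j| <= 1.
Proof.
move=> /unitarymxP/matrixP/(_ i i); rewrite !mxE eqxx => /esym U1.
rewrite -(@expr_le1 _ 2) // [leRHS](U1 : 1 = _) (bigD1 j) //= !mxE -normCK lerDl.
by apply: sumr_ge0 => k _; rewrite !mxE -normCK exprn_ge0.
Qed.

Lemma norm_Re_Im_le1 (C : numClosedFieldType) (z : C) :
  `|z| <= 1 -> `|'Re z| <= 1 /\ `|'Im z| <= 1.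
Proof.
move=> z1; have : `|z| ^+ 2 <= 1 by rewrite exprn_ile1.
rewrite normC2_Re_Im => sq1; split; rewrite -(@expr_le1 _ 2) // real_normK //;
by apply: le_trans sq1; rewrite ?lerDl ?lerDr -realEsqr.
Qed.

(** Pigeonhole on the real and imaginary parts of the n^2 entries, in cells of side 1/(3n). Two
    matrices sharing all cells are at squared distance at most n^2 * 2/(9n^2) = 2/9 < 1/4, so
    distinct points of [A] occupy distinct cells. *)
Lemma card_separated_unitary (T : finType) (A : pred T) n (U : T -> 'M[algC]_n) :
    (0 < n)%N -> (forall x, x \in A -> U x \is unitarymx) ->
    (forall x y, x \in A -> y \in A -> x != y -> 4^-1 <= sqnormmx (U x - U y)) ->
  (#|A| <= (6 * n).+1 ^ (2 * n ^ 2))%N.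
Proof.
move=> n_gt0 unitaryU sepU.
pose cell x := [ffun ij : 'I_n * 'I_n =>
  (grid_cell n ('Re (U x ij.1 ij.2)), grid_cell n ('Im (U x ij.1 ij.2)))].
have cell_inj : {in A &, injective cell}.
  move=> x y Ax Ay eq_cell; apply/eqP; apply: contraT => /(sepU x y Ax Ay).
  have c_gt0 : 0 < (3 * n)%:R ^+ 2 :> algC by rewrite exprn_gt0 // ltr0n muln_gt0.
  have close i j : `|(U x - U y) i j| ^+ 2 <= 2 / (3 * n)%:R ^+ 2.
    have := congr1 (fun f : {ffun 'I_n * 'I_n -> _} => f (i, j)) eq_cell.
    rewrite /cell !ffunE /= => -[closeRe closeIm].
    have [xRe xIm] := norm_Re_Im_le1 (unitarymx_entry i j (unitaryU x Ax)).
    have [yRe yIm] := norm_Re_Im_le1 (unitarymx_entry i j (unitaryU y Ay)).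
    rewrite ler_pdivlMr // !mxE normC2_Re_Im !raddfB /=.
    rewrite mulrDl -!exprMn ![_ * (3 * n)%:R]mulrC [leRHS]mulr2n lerD //.
      by apply: grid_cell_close; rewrite ?Creal_Re.
    by apply: grid_cell_close; rewrite ?Creal_Im.
  have : sqnormmx (U x - U y) <= (n ^ 2)%:R * (2 / (3 * n)%:R ^+ 2).
    have -> : (n ^ 2)%:R * (2 / (3 * n)%:R ^+ 2)
        = \sum_(i < n) \sum_(j < n) (2 / (3 * n)%:R ^+ 2) :> algC.
      by rewrite !sumr_const !card_ord -mulrnA mulnn mulr_natl.
    by apply: ler_sum => i _; apply: ler_sum => j _.
  have n0 : n%:R != 0 :> algC by rewrite pnatr_eq0 -lt0n.
  rewrite natrX natrM (_ : _ * _ = 2 / 9) => [le29 le14|]; last by field.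
  have := le_trans le14 le29.
  by rewrite ler_pdivlMr ?ltr0n // mulrC ler_pdivrMr ?ltr0n // -!natrM ler_nat.
apply: leq_trans (leq_card_in _ _ cell_inj) _.
by rewrite card_ffun !card_prod !card_ord !mulnn -expnM.
Qed.

(** Simplicity makes a nontrivial character faithful. A linear one would have the derived subgroup
    in its trivial kernel, so G would be abelian; the cardinality bound is packing applied to a
    unitary form. *)
Lemma simple_irr_degree (gT : finGroupType) (G : {group gT}) (i : Iirr G) :
    simple G -> ~~ abelian G -> i != 0 ->
  exists2 d : nat, 'chi_i 1%g = d%:R &
    (1 < d)%N /\ (#|G| <= (6 * d).+1 ^ (2 * d ^ 2))%N.
Proof.
move=> simpleG nabG i0; exists (irr_degree (socle_of_Iirr i)).
  exact: irr1_degree.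
set d := irr_degree _.
have faith : cfker 'chi_i = 1%g.
  have [_ /(_ _ (cfker_normal 'chi_i)) [//|EG]] := simpleP _ simpleG.
  by move: i0; rewrite -subGcfker EG subxx.
have d_gt1 : (1 < d)%N.
  rewrite ltn_neqAle irr_degree_gt0 andbT eq_sym; apply: contra nabG => /eqP d1.
  have := lin_irr_der1 i; rewrite qualifE /= irr_char irr1_degree -/d d1 eqxx.
  move/esym; rewrite faith => /trivgP G1.
  by apply/commG1P.
split=> //.
have [rU kerU unitaryU] := unitary_conjugate 'Chi_i.
apply: (card_separated_unitary (ltnW d_gt1) unitaryU) => x y Gx Gy.
apply: simple_unitary_separated => //.
by rewrite /mx_faithful kerU -cfker_repr irrRepr faith.
Qed.

End UnitaryRepresentations.

(** * Protocols *)

(** Induction on the tree: each bit cuts the current rectangle into two rectangles. At a leaf the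
    output minus 1/2 is 1/2 in absolute value, which turns the hypothesis 2e into e. *)
Lemma protocol_discrepancy (R : realFieldType) (X Y : finType) (w : X -> Y -> R)
    (e : R) :
    (forall (A : pred X) (B : pred Y),
       `|\sum_(x | A x) \sum_(y | B y) w x y| <= 2 * e) ->
  forall (p : protocol X Y) (A : pred X) (B : pred Y),
    `|\sum_(x | A x) \sum_(y | B y) w x y * ((run p x y)%:R - 2^-1)|
      <= 2 ^+ cost p * e.
Proof.
move=> w_le; have e_ge0 : 0 <= e.
  by have := le_trans (normr_ge0 _) (w_le predT predT); rewrite pmulr_rge0.
have pow_le m n : (m <= n)%N -> 2 ^+ m * e <= 2 ^+ n * e.
  by move=> le_mn; rewrite ler_wpM2r // ler_weXn2l // ler1n.
elim=> [z|f p0 IH0 p1 IH1|f p0 IH0 p1 IH1] A B /=.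
- rewrite expr0 mul1r.
  under eq_bigr => x _ do rewrite -mulr_suml.
  rewrite -mulr_suml normrM.
  have -> : `|z%:R - 2^-1| = 2^-1 :> R.
    case: z; rewrite /= ?sub0r ?normrN ?ger0_norm ?invr_ge0 ?ler0n //; lra.
  by rewrite ler_pdivrMr // mulrC.
- have -> : \sum_(x | A x) \sum_(y | B y)
        w x y * ((if f x then run p1 x y else run p0 x y)%:R - 2^-1)
      = \sum_(x | A x && f x) \sum_(y | B y) w x y * ((run p1 x y)%:R - 2^-1)
      + \sum_(x | A x && ~~ f x) \sum_(y | B y) w x y * ((run p0 x y)%:R - 2^-1).
    rewrite (bigID f) /=; congr (_ + _).
      by apply: eq_bigr => x /andP[_ ->].
    by apply: eq_bigr => x /andP[_ /negPf->].
  rewrite exprS -mulrA mulr2n mulrDl mul1r (le_trans (ler_normD _ _)) // lerD //.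
    exact: le_trans (IH1 [pred x | A x && f x] B) (pow_le _ _ (leq_maxr _ _)).
  exact: le_trans (IH0 [pred x | A x && ~~ f x] B) (pow_le _ _ (leq_maxl _ _)).
- have -> : \sum_(x | A x) \sum_(y | B y)
        w x y * ((if f y then run p1 x y else run p0 x y)%:R - 2^-1)
      = \sum_(x | A x) \sum_(y | B y && f y) w x y * ((run p1 x y)%:R - 2^-1)
      + \sum_(x | A x) \sum_(y | B y && ~~ f y) w x y * ((run p0 x y)%:R - 2^-1).
    rewrite -big_split; apply: eq_bigr => x _; rewrite (bigID f) /=; congr (_ + _).
      by apply: eq_bigr => y /andP[_ ->].
    by apply: eq_bigr => y /andP[_ /negPf->].
  rewrite exprS -mulrA mulr2n mulrDl mul1r (le_trans (ler_normD _ _)) // lerD //.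
    exact: le_trans (IH1 A [pred y | B y && f y]) (pow_le _ _ (leq_maxr _ _)).
  exact: le_trans (IH0 A [pred y | B y && ~~ f y]) (pow_le _ _ (leq_maxl _ _)).
Qed.

(** The weighted sum of probabilities is the expectation of the weighted sum of indicators, so a
    bound valid for every outcome of the coins passes to the average. *)
Lemma norm_sum_prob_le (R : realType) (d : measure_display) (C : measurableType d)
    (mu : probability C R) (I : finType) (w : I -> R) (E : I -> set C) (e : R) :
    (forall i, measurable (E i)) ->
    (forall x, `|\sum_i w i * (x \in E i)%:R| <= e) ->
  `|\sum_i w i * fine (mu (E i))| <= e.
Proof.
move=> mE w_le; pose f i x := w i * \1_(E i) x.
have int_ind i : mu.-integrable setT (EFin \o (\1_(E i) : C -> R)).
  exact: integrable_indic.
have int_f i : mu.-integrable setT (EFin \o f i).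
  exact: (integrableZl measurableT (w i) (int_ind i)).
have int_sum : mu.-integrable setT (EFin \o (fun x => \sum_i f i x)).
  rewrite (_ : _ \o _ = fun x => (\sum_i (f i x)%:E)%E); last first.
    by apply/funext => x; rewrite /= sumEFin.
  by apply: integrable_sum => // i _; exact: int_f.
have -> : \sum_i w i * fine (mu (E i)) = \int[mu]_x (\sum_i f i x).
  rewrite /Rintegral.
  under eq_integral => x _ do rewrite -sumEFin.
  rewrite integral_sum // -[LHS]/(fine (_ : R)%:E) -sumEFin; congr fine.
  apply: eq_bigr => i _; rewrite EFinM.
  under eq_integral => x _ do rewrite /f EFinM.
  rewrite (integralZl measurableT (int_ind i)).
  rewrite (integral_indic _ measurableT (mE i)) setIT fineK //.
  exact: fin_num_measure.
apply: le_trans (le_normr_Rintegral _ _) _ => //.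
have -> : e = \int[mu]_x (cst e x).
  by rewrite Rintegral_cst //= probability_setT mulr1.
apply: le_Rintegral => //.
- exact: integrable_norm int_sum.
- exact: finite_measure_integrable_cst.
- move=> x _; apply: le_trans (w_le x); rewrite le_eqVlt; apply/orP; left.
  by apply/eqP; congr `|_|; apply: eq_bigr => i _; rewrite /f indicE.
Qed.

Lemma sum_interleave_indicator (R : pzSemiRingType) (gT : finGroupType) n g :
  \sum_(a : n.-tuple gT) \sum_(b : n.-tuple gT) (interleave a b == g)%:R
    = #|[pred ab : n.-tuple gT * n.-tuple gT | interleave ab.1 ab.2 == g]|%:R :> R.
Proof. by rewrite pair_bigA -sumr_bool; apply: eq_bigr. Qed.

Lemma card_interleave_fiber (gT : finGroupType) n (g : gT) :
  (#|gT| * #|[pred ab : n.+1.-tuple gT * n.+1.-tuple gT |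
      interleave ab.1 ab.2 == g]| = #|gT| ^ (2 * n.+1))%N.
Proof.
apply/eqP; rewrite -(eqr_nat int) natrM natrX; apply/eqP.
rewrite -sum_interleave_indicator exchange_big mulr_sumr /=.
under eq_bigr => b _ do rewrite sum_interleave_fiber.
by rewrite sumr_const card_tuple -[LHS]mulr_natl natrX -exprD addnn mul2n.
Qed.

Lemma accept_prob_dist (R : realType) (d : measure_display) (C : measurableType d)
    (mu : probability C R) (G : finGroupType) n c m
    (P : public_coin_protocol C (n.+1.-tuple G) (n.+1.-tuple G) c) (g h : G) :
    (0 < m)%N ->
    (forall i : Iirr [set: G], i != 0 -> m%:R <= 'chi_i 1%g) ->
  `|accept_prob mu P g - accept_prob mu P h| <= 2 ^+ c / m%:R ^+ n.
Proof.
move=> m_gt0 m_le; pose N : R := #|G|%:R; pose M := N ^+ (2 * n.+1) / N.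
have N_gt0 : 0 < N by rewrite ltr0n -cardsT cardG_gt0.
have M_gt0 : 0 < M by rewrite divr_gt0 ?exprn_gt0.
have mn_gt0 : 0 < m%:R ^+ n :> R by rewrite exprn_gt0 ?ltr0n.
pose D (a b : n.+1.-tuple G) : R := (interleave a b == g)%:R - (interleave a b == h)%:R.
have fiberM k : #|[pred ab : n.+1.-tuple G * n.+1.-tuple G |
    interleave ab.1 ab.2 == k]|%:R = M.
  rewrite /M -natrX -(card_interleave_fiber n k) natrM mulrC mulKf //.
  by rewrite gt_eqF.
have ND a b : N * D a b = (imbalance int g a b - imbalance int h a b)%:~R.
  by rewrite /imbalance /D !rmorphB !rmorphM !rmorph_nat /N /=; ring.
(* The factor 2 is the triangle inequality between the imbalances of [g] and [h]. *)
have rect (A B : pred (n.+1.-tuple G)) :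
    `|\sum_(a | A a) \sum_(b | B b) D a b| <= 2 * (M / m%:R ^+ n).
  have imb k : `|\sum_(a | A a) \sum_(b | B b) (imbalance int k a b)%:~R| <=
      N ^+ (2 * n.+1) / m%:R ^+ n :> R.
    rewrite ler_pdivlMr // mulrC.
    have := rectangle_imbalance k A B m_le; rewrite -(ler_int R).
    rewrite rmorphM !rmorphXn /= !rmorph_nat intr_norm rmorph_sum /=.
    by under eq_bigr => a _ do rewrite rmorph_sum.
  rewrite -(ler_pM2l N_gt0) -{1}(ger0_norm (ltW N_gt0)) -normrM.
  have -> : N * (\sum_(a | A a) \sum_(b | B b) D a b)
      = \sum_(a | A a) \sum_(b | B b) (imbalance int g a b)%:~R
      - \sum_(a | A a) \sum_(b | B b) (imbalance int h a b)%:~R.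
    rewrite mulr_sumr -sumrB; apply: eq_bigr => a _.
    rewrite mulr_sumr -sumrB; apply: eq_bigr => b _.
    by rewrite ND rmorphB.
  apply: le_trans (ler_normB _ _) _; apply: le_trans (lerD (imb g) (imb h)) _.
  by rewrite /M le_eqVlt; apply/orP; left; apply/eqP; field; rewrite !gt_eqF.
(* All fibres have the same size, so [D] has total mass zero; this permits the shift of the output
   by 1/2 below. *)
have D0 : \sum_a \sum_b D a b = 0.
  have sum_fiber k : \sum_(a : n.+1.-tuple G) \sum_(b : n.+1.-tuple G)
      (interleave a b == k)%:R = M.
    by rewrite sum_interleave_indicator.
  under eq_bigr => a _ do rewrite sumrB.
  by rewrite sumrB !sum_fiber subrr.
have -> : accept_prob mu P g - accept_prob mu P h =
    (\sum_(ab : n.+1.-tuple G * n.+1.-tuple G) D ab.1 ab.2 *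
       fine (mu [set w | run (P w) ab.1 ab.2]%classic)) / M.
  rewrite /accept_prob !fiberM -mulrBl; congr (_ / _).
  rewrite big_mkcond [in X in _ - X]big_mkcond -sumrB; apply: eq_bigr => ab _.
  by rewrite /D mulrBl; congr (_ - _); case: (_ == _); rewrite ?mul1r ?mul0r.
rewrite normrM normfV (gtr0_norm M_gt0) ler_pdivrMr //.
apply: norm_sum_prob_le => [ab|w]; first exact: det_protocol_measurable.
have -> : \sum_ab D ab.1 ab.2 * (w \in [set w | run (P w) ab.1 ab.2]%classic)%:R
    = \sum_(a | predT a) \sum_(b | predT b) D a b * ((run (P w) a b)%:R - 2^-1).
  transitivity (\sum_a \sum_b D a b * (run (P w) a b)%:R).
    rewrite pair_bigA; apply: eq_bigr => ab _ /=; congr (_ * _%:R).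
    by congr nat_of_bool; apply/idP/idP; rewrite inE.
  under [RHS]eq_bigr => a _ do
    (under eq_bigr => b _ do rewrite mulrBr; rewrite sumrB -mulr_suml).
  by rewrite sumrB -mulr_suml D0 mul0r subr0.
apply: le_trans (protocol_discrepancy rect _ _ _) _.
rewrite [leRHS]mulrAC -[leRHS]mulrA ler_wpM2r //.
  exact/ltW/divr_gt0.
by rewrite ler_weXn2l ?ler1n // det_protocol_cost.
Qed.

(** * Least character degree and the final exponent *)

Lemma simple_quasirandom (R : realType) (gT : finGroupType) :
    simple [set: gT]%SET -> ~~ abelian [set: gT]%SET ->
  exists2 m : nat, [/\ (1 < m)%N & ln (#|gT|%:R : R) <= m%:R ^+ 7] &
    forall i : Iirr [set: gT], i != 0 -> m%:R <= 'chi_i 1%g.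
Proof.
move=> simpleG nabG; have [G1 _] := simpleP _ simpleG.
have [i0 i0_neq0] := has_nonprincipal_irr G1.
pose deg (i : Iirr [set: gT]) := irr_degree (socle_of_Iirr i).
have [j j0 jmin] := @arg_minnP _ i0 (fun i => i != 0) deg i0_neq0.
exists (deg j); last first.
  by move=> i /jmin; rewrite irr1_degree ler_nat.
have [m] := simple_irr_degree simpleG nabG j0.
rewrite irr1_degree => /eqP; rewrite eqr_nat -/(deg j) => /eqP-> [m_gt1 leG].
split=> //.
have lnG : ln (#|gT|%:R : R) <= ln ((6 * m).+1%:R ^+ (2 * m ^ 2)).
  by rewrite ler_ln ?posrE ?exprn_gt0 ?ltr0n // -?natrX ?ler_nat -cardsT ?cardG_gt0.
apply: le_trans lnG _; rewrite lnXn ?ltr0n // -[leLHS]mulr_natl.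
have : ln (6 * m).+1%:R <= (6 * m)%:R :> R.
  rewrite -natr1 addrC; apply: le_ln1Dx.
  by apply: lt_le_trans (ler0n _ _); rewrite oppr_lt0.
move=> ln6m; apply: le_trans (ler_wpM2l (ler0n _ _) ln6m) _.
rewrite -natrM -natrX ler_nat.
(* The bound so far is 2m^2 * 6m = 12 m^3; since m >= 2, 12 <= m^4, whence the exponent 7. *)
have m4 : (2 ^ 4 <= m ^ 4)%N by rewrite leq_exp2r.
rewrite (expnD m 4 3) (_ : _ * _ = 12 * m ^ 3)%N; last by rewrite !expnS; lia.
by rewrite leq_mul2r (leq_trans _ m4) ?orbT.
Qed.

Theorem corollary3p4 (R : realType) :
  exists c0 : R, 0 < c0 /\
    forall (G : finGroupType) (t c : nat)
      (d : measure_display) (C : measurableType d) (mu : probability C R)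
      (P : public_coin_protocol C (t.-tuple G) (t.-tuple G) c),
      simple [set: G]%SET -> ~~ abelian [set: G]%SET -> (2 <= t)%N ->
      forall g h : G,
        `|accept_prob mu P g - accept_prob mu P h|
          <= 2 ^+ c * ln (#|G|%:R : R) `^ (- (c0 * t%:R)).
Proof.
(* 1/14 = 1/7 * 1/2: the least degree is at least (ln|G|)^(1/7), and its exponent t - 1 is at least
   t/2 for t >= 2. *)
exists (14%:R^-1); split=> [|G t c d C mu P simpleG nabG].
  by rewrite invr_gt0 ltr0n.
case: t P => [|n] //= P n_gt0 g h.
have [m [m_gt1 lnG] m_le] := simple_quasirandom R simpleG nabG.
apply: le_trans (accept_prob_dist mu P g h (ltnW m_gt1) m_le) _.
rewrite ler_pM2l ?exprn_gt0 // powRN.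
have G_gt1 : (1 < #|G|)%N.
  by have [G1 _] := simpleP _ simpleG; rewrite -cardsT cardG_gt1.
have lnG_gt0 : 0 < ln (#|G|%:R : R) by rewrite ln_gt0 // ltr1n.
have m_gt0 : 0 < m%:R :> R by rewrite ltr0n ltnW.
rewrite lef_pV2 ?posrE ?exprn_gt0 ?powR_gt0 //.
apply: le_trans (ge0_ler_powR _ _ _ lnG) _; rewrite ?nnegrE ?exprn_ge0 ?mulr_ge0
  ?invr_ge0 ?ler0n ?(ltW lnG_gt0) //.
rewrite -powR_mulrn ?ler0n // -powRrM -powR_mulrn ?ler0n //.
(* Both sides are now powers of [m], with exponents 7(n+1)/14 and n. *)
apply: ler_powR; first by rewrite ler1n ltnW.
have : 2 <= n.+1%:R :> R by rewrite ler_nat.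
rewrite -natr1; lra.
Qed.
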